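(* Let $R$ be a commutative ring, $(A,m_k)_{k\ge0}$ a curved $A_\infty$-algebra over $R$, and $V$ a graded $R$-module. Let $i:V\to A$ and $p:A\to V$ be $R$-linear maps of degree zero and $H:A\to A$ an $R$-linear map of degree $-1$. Assume there is $C\in V$ of degree $2$ with $i(C)=m_0$ and that $$m_1H+Hm_1=ip-\mathrm{id}_A-Hm_1^2H,\qquad p\,m_1H=0,\qquad Hm_1\,i=0.$$ Then there is a curved $A_\infty$-algebra structure $(\mu_k)_{k\ge0}$ on $V$ with $\mu_0=C$ and $\mu_1=p\,m_1\,i$. Moreover there is an $A_\infty$-homomorphism $\varphi:(V,\mu_k)\to(A,m_k)$ with $\varphi_1=i$.
   Context: A curved $A_\infty$-algebra over $R$ is a $\mathbb{Z}$-graded $R$-module $A$ with $R$-multilinear maps $m_k:A[1]^{\otimes k}\to A[1]$, $k\ge0$, of degree $1$ (so $m_0\in A$ has degree $2$), such that for all $n\ge0$ $$\sum_{r+s+t=n}m_{r+1+t}(\mathrm{id}^{\otimes r}\otimes m_s\otimes\mathrm{id}^{\otimes t})=0,$$ where applied to $a_1,\ldots,a_n$ the summand carries the sign $(-1)^{|a_1|'+\cdots+|a_r|'}$, $|a|'=|a|-1$. In particular $m_1^2$ need not vanish. No condition is imposed on the curvature $m_0$. An $A_\infty$-homomorphism $\varphi:(V,\mu_k)\to(A,m_k)$ is a sequence of degree zero $R$-multilinear maps $\varphi_k:V[1]^{\otimes k}\to A[1]$, $k\ge1$ (there is no $\varphi_0$ term), such that for all $n\ge0$ $$\sum_{j\ge0,\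 i_1+\cdots+i_j=n,\ i_l\ge1}m_j(\varphi_{i_1}\otimes\cdots\otimes\varphi_{i_j})=\sum_{r+s+t=n}\varphi_{r+1+t}(\mathrm{id}^{\otimes r}\otimes\mu_s\otimes\mathrm{id}^{\otimes t}),$$ with the same sign convention on the right; for $n=0$ this reads $m_0=\varphi_1(\mu_0)$. *)

(* Defs.v *)
From HB Require Import structures.
From mathcomp Require Import all_boot all_order all_algebra.
Set Implicit Arguments.
Unset Strict Implicit.
Unset Printing Implicit Defensive.
Import GRing.Theory.
Local Open Scope ring_scope.

(* Internal gradings: [piece A d] is the submodule of elements of degree [d],
   and the module is the direct sum of its pieces. *)
Record gradedModule (R : comPzRingType) := GradedModule {
  gmod :> lmodType R;
  piece : int -> gmod -> Prop;
  piece0 : forall d, piece d 0;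
  pieceP : forall d (c : R) x y, piece d x -> piece d y -> piece d (c *: x + y);
  piece_span : forall x, exists (s : seq int) (f : int -> gmod),
    (forall d, piece d (f d)) /\ x = \sum_(d <- s) f d;
  piece_indep : forall (s : seq int) (f : int -> gmod),
    uniq s -> (forall d, piece d (f d)) -> \sum_(d <- s) f d = 0 ->
    forall d, d \in s -> f d = 0
}.

Definition map_degree (R : comPzRingType) (A B : gradedModule R)
    (e : int) (f : A -> B) : Prop :=
  forall d x, piece d x -> piece (d + e) (f x).

(* A family of maps f_k : V^k -> W, k >= 0, is encoded as one function
   [f : seq V -> W], with f_k its restriction to the sequences of size k. *)

Definition multilinear (R : comPzRingType) (V W : lmodType R)
    (f : seq V -> W) : Prop :=
  forall s t : seq V, linear (fun x : V => f (s ++ x :: t)).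

Definition homogeneous (R : comPzRingType) (V : gradedModule R)
    (d : seq int) (a : seq V) : Prop :=
  size d = size a /\ forall k, (k < size a)%N -> piece d`_k a`_k.

(* |a_1|' + ... + |a_n|' with |a|' = |a| - 1, where [d] lists the |a_l| *)
Definition sdeg (d : seq int) : int := \sum_(x <- d) (x - 1).

(* Each f_k : V[1]^{(x) k} -> W[1] has degree [e]; the degree q piece of W[1]
   is the degree q + 1 piece of W. *)
Definition shifted_degree (R : comPzRingType) (V W : gradedModule R)
    (e : int) (f : seq V -> W) : Prop :=
  forall (d : seq int) (a : seq V), homogeneous d a ->
    piece (sdeg d + e + 1) (f a).

(* The sum over r + s + t = n of f_{r+1+t} (id^r (x) g_s (x) id^t) evaluated at
   a = (a_1, ..., a_n) of degrees d, with sign (-1)^(|a_1|' + ... + |a_r|');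
   here t = n - r - s. *)
Definition insertion_sum (R : comPzRingType) (V W : lmodType R)
    (f : seq V -> W) (g : seq V -> V) (d : seq int) (a : seq V) : W :=
  \sum_(r < (size a).+1) \sum_(s < (size a - r).+1)
    ((-1) ^+ `|sdeg (take r d)|%N : R) *:
      f (take r a ++ g (take s (drop r a)) :: drop (r + s) a).

(* The sum over j >= 0 and i_1 + ... + i_j = n, i_l >= 1, of
   m_j (phi_{i_1} (x) ... (x) phi_{i_j}) evaluated at a = (a_1, ..., a_n).
   Such j and i_l are at most n, hence the finite index types. *)
Definition composition_sum (R : comPzRingType) (V W : lmodType R)
    (m : seq W -> W) (phi : seq V -> W) (a : seq V) : W :=
  \sum_(j < (size a).+1)
    \sum_(c : j.-tuple 'I_(size a).+1 |
           all (fun x : 'I_(size a).+1 => 0 < x)%N c &&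
           (sumn (map val c) == size a))
      m (map phi (reshape (map val c) a)).

Record curvedAinf (R : comPzRingType) (A : gradedModule R) := CurvedAinf {
  ainf_op :> seq A -> A;
  ainf_multilinear : multilinear ainf_op;
  ainf_degree : shifted_degree 1 ainf_op;
  ainf_rel : forall (d : seq int) (a : seq A), homogeneous d a ->
    insertion_sum ainf_op ainf_op d a = 0
}.

(* [ainf_hom0] discards the junk value at the empty sequence: there is no
   phi_0, and the relations below never use it. *)
Record ainfHom (R : comPzRingType) (V A : gradedModule R)
    (mu : curvedAinf V) (m : curvedAinf A) := AinfHom {
  ainf_hom :> seq V -> A;
  ainf_hom0 : ainf_hom [::] = 0;
  ainf_hom_multilinear : multilinear ainf_hom;
  ainf_hom_degree : shifted_degree 0 ainf_hom;
  ainf_hom_rel : forall (d : seq int) (a : seq V), homogeneous d a ->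
    composition_sum m ainf_hom a = insertion_sum ainf_hom mu d a
}.

(* Main.v *)
(* On the bar side write m, phi, mu also for the induced coderivations and
   coalgebra map, and split m = m_1 + m'.  The transferred structure solves
   phi = i + H m' phi, mu = p m phi (with mu_0 = C); since p m_1 H = 0, the
   latter is p m_1 i in arity one and p m' phi in higher arities.  Let
   E = m phi - phi mu and suppose E vanishes in lower arities.  Substituting
   m phi = phi mu + E into the relation m m phi = 0 gives
   (m phi) mu = - m_1 E in the current arity.  Applying H and writing
   B = m' phi, X = H (B mu), with H m_1 i = 0, this is
   X + H m_1 X = - H m_1 E, while the homotopy identity at B says
   E = - H m_1 B - H m_1^2 H B - X.  Applying H m_1 to E = B + m_1 H B - i p B - X
   then forces X = - H m_1 B - H m_1^2 H B, that is E = 0.  In arity one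
   the homotopy identity at m_1 i v and the A_infinity relation for m_1^2 give
   E = 0 directly.  Finally mu mu = p (m phi) mu = p (m m phi) = 0. *)
Require Import Defs.
From HB Require Import structures.
From mathcomp Require Import all_boot all_order all_algebra zify ring.
Set Implicit Arguments.
Unset Strict Implicit.
Unset Printing Implicit Defensive.
Import GRing.Theory.
Local Open Scope ring_scope.

(** * Cuts and decompositions of sequences *)

(** The terms of the deconcatenation coproduct. Nested cuts replace the triples r + s + t = n, so
    that iterated sums are regrouped without index arithmetic. *)
Fixpoint cuts T (a : seq T) : seq (seq T * seq T) :=
  ([::], a) :: if a is x :: a' then [seq (x :: c.1, c.2) | c <- cuts a'] else [::].

(** Decompositions into consecutive nonempty blocks: the first entry is a block by itself or joins
    the first block of the rest. The filter drops the empty decomposition, which has no block to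
    join. *)
Fixpoint decs T (a : seq T) : seq (seq (seq T)) :=
  if a is x :: a' then
    [seq [:: x] :: bs | bs <- decs a'] ++
    [seq (x :: head [::] bs) :: behead bs | bs <- decs a' & 0 < size bs]%N
  else [:: [::]].

Section Cuts.
Context {T : Type} {U : zmodType}.
Implicit Types (a : seq T).

Lemma big_cuts_nil (P : seq T -> seq T -> U) :
  \sum_(c <- cuts [::]) P c.1 c.2 = P [::] [::].
Proof. by rewrite big_seq1. Qed.

Lemma big_cuts_cons (P : seq T -> seq T -> U) x a :
  \sum_(c <- cuts (x :: a)) P c.1 c.2 =
  P [::] (x :: a) + \sum_(c <- cuts a) P (x :: c.1) c.2.
Proof. by rewrite /= big_cons big_map. Qed.

Lemma big_cuts_take_drop (P : seq T -> seq T -> U) a :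
  \sum_(c <- cuts a) P c.1 c.2 = \sum_(r < (size a).+1) P (take r a) (drop r a).
Proof.
elim: a P => [|x a IH] P; first by rewrite big_cuts_nil big_ord1.
by rewrite big_cuts_cons big_ord_recl (IH (fun u => P (x :: u))).
Qed.

(** Coassociativity of deconcatenation. *)
Lemma big_cuts_coassoc (P : seq T -> seq T -> seq T -> U) a :
  \sum_(c <- cuts a) \sum_(e <- cuts c.1) P e.1 e.2 c.2 =
  \sum_(c <- cuts a) \sum_(e <- cuts c.2) P c.1 e.1 e.2.
Proof.
elim: a P => [|x a IH] P; first by rewrite !big_seq1.
rewrite (big_cuts_cons (fun u v => \sum_(e <- cuts u) P e.1 e.2 v)).
rewrite (big_cuts_cons (fun u v => \sum_(e <- cuts v) P u e.1 e.2)).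
rewrite -(IH (fun u => P (x :: u))) (big_cuts_nil (fun u1 u2 => P u1 u2 _)).
rewrite (big_cuts_cons (fun u v => P [::] u v)) -addrA; congr (_ + _).
rewrite -big_split; apply: eq_bigr => c _ /=.
by rewrite big_cons big_map.
Qed.

End Cuts.

Section Decompositions.
Context {T : Type} {U : zmodType}.
Implicit Types (a u v : seq T) (bs : seq (seq T)).

Lemma big_decs_nil (P : seq (seq T) -> U) : \sum_(bs <- decs [::]) P bs = P [::].
Proof. by rewrite big_seq1. Qed.

Lemma big_decs_cons (P : seq (seq T) -> U) x a :
  \sum_(bs <- decs (x :: a)) P bs =
  \sum_(bs <- decs a)
    (P ([:: x] :: bs) + if bs is b :: bs' then P ((x :: b) :: bs') else 0).
Proof.
rewrite /= big_cat !big_map big_filter [X in _ + X = _]big_mkcond big_split /=.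
congr (_ + _).
by apply: eq_bigr => -[].
Qed.

Lemma big_decs_nilp (K : U) a :
  \sum_(bs <- decs a) (if nilp bs then K else 0) = if nilp a then K else 0.
Proof.
case: a => [|x a]; first by rewrite big_decs_nil.
by rewrite big_decs_cons big1 // => -[] *; rewrite addr0.
Qed.

(** Flattening turns a cut between blocks into a cut of the word that no block straddles. This
    transports relations on sequences of blocks to relations on words. *)
Lemma big_cuts_decs (P : seq (seq T) -> seq (seq T) -> U) a :
  \sum_(bs <- decs a) \sum_(c <- cuts bs) P c.1 c.2 =
  \sum_(c <- cuts a) \sum_(L <- decs c.1) \sum_(R <- decs c.2) P L R.
Proof.
elim: a P => [|x a IH] P.
  by rewrite big_seq1 big_seq1 big_seq1 big_seq1 big_decs_nil.
(* [Q] gathers both ways of attaching [x] to the left part; an empty left part has no block to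
   extend. *)
pose Q L R := P ([:: x] :: L) R + if L is b :: L' then P ((x :: b) :: L') R else 0.
rewrite (big_cuts_cons (fun u v => \sum_(L <- decs u) \sum_(R <- decs v) P L R)).
rewrite big_decs_nil.
under [X in _ = _ + X]eq_bigr => c _.
  rewrite big_decs_cons.
  under eq_bigr => L _.
    have -> : \sum_(R <- decs c.2) P ([:: x] :: L) R +
       (if L is b :: L' then \sum_(R <- decs c.2) P ((x :: b) :: L') R else 0)
       = \sum_(R <- decs c.2) Q L R.
      rewrite big_split; case: L => [|b L] //=.
      by rewrite big1_eq.
    over.
  over.
rewrite -(IH Q) big_decs_cons.
rewrite big_decs_cons -big_split.
apply: eq_bigr => bs _ /=.
rewrite (big_cuts_cons P) -!addrA; congr (_ + _).
case: bs => [|b bs]; first by rewrite add0r !big_seq1 /Q /= addr0.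
rewrite (big_cuts_cons P) (big_cuts_cons Q).
rewrite (big_cuts_cons (fun L R => P ([:: x] :: L) R)).
rewrite /Q addr0 big_split /= addrACA !addrA.
do 2 congr (_ + _).
by rewrite addrC.
Qed.

Lemma big_decs_first (P : seq (seq T) -> U) x a :
  \sum_(bs <- decs (x :: a)) P bs =
  \sum_(c <- cuts a) \sum_(bs <- decs c.2) P ((x :: c.1) :: bs).
Proof.
elim: a P x => [|y a IH] P x; first by rewrite /= !big_seq1.
rewrite (big_cuts_cons (fun u v => \sum_(bs <- decs v) P ((x :: u) :: bs))).
by rewrite big_decs_cons big_split; congr (_ + _); rewrite IH.
Qed.

(* The middle block of a decomposition is the one containing [y]. *)
Lemma big_decs_mid (P : seq (seq T) -> U) u y v :
  \sum_(bs <- decs (u ++ y :: v)) P bs =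
  \sum_(c <- cuts u) \sum_(e <- cuts v) \sum_(L <- decs c.1) \sum_(R <- decs e.2)
    P (L ++ (c.2 ++ y :: e.1) :: R).
Proof.
elim: u P => [|x u IH] P.
  rewrite big_seq1 big_decs_first; apply: eq_bigr => e _.
  by rewrite big_decs_nil.
rewrite (big_cuts_cons (fun u1 u2 => \sum_(e <- cuts v) \sum_(L <- decs u1)
    \sum_(R <- decs e.2) P (L ++ (u2 ++ y :: e.1) :: R))).
rewrite cat_cons big_decs_cons IH.
(* [K u2] collects the terms where [x] opens the block of [y]. It is spread over the cuts of [u],
   supported at the empty prefix, so that both sides compare termwise. *)
pose K u2 := \sum_(e <- cuts v) \sum_(R <- decs e.2) P ((x :: u2 ++ y :: e.1) :: R).
have -> : \sum_(e <- cuts v) \sum_(L <- decs [::])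
   \sum_(R <- decs e.2) P (L ++ (((x :: u) ++ y :: e.1) :: R)) = K u.
  by apply: eq_bigr => e _; rewrite big_decs_nil.
have -> : K u = \sum_(c <- cuts u) if nilp c.1 then K c.2 else 0.
  case: u {IH} => [|z u]; first by rewrite big_seq1.
  rewrite (big_cuts_cons (fun u1 u2 => if nilp u1 then K u2 else 0)).
  by rewrite big1 ?addr0.
rewrite -big_split; apply: eq_bigr => c _ /=.
have -> : (if nilp c.1 then K c.2 else 0) = \sum_(e <- cuts v) \sum_(L <- decs c.1)
   (if nilp L then \sum_(R <- decs e.2) P ((x :: c.2 ++ y :: e.1) :: R) else 0).
  rewrite /K; under [RHS]eq_bigr do rewrite big_decs_nilp.
  by case: nilp => //; rewrite big1_eq.
rewrite -big_split; apply: eq_bigr => e _ /=.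
rewrite (big_decs_cons _ x c.1) -big_split; apply: eq_bigr => -[|b L] _ /=.
  by rewrite big_split addr0 addrC.
by rewrite big_split add0r.
Qed.

(** Separates m_1 phi from the terms of m phi that involve only shorter words. *)
Lemma big_decs_split1 (P : seq (seq T) -> U) a : (0 < size a)%N ->
  \sum_(bs <- decs a) P bs = P [:: a] + \sum_(bs <- decs a | (1 < size bs)%N) P bs.
Proof.
case: a => // x a _; elim: a x P => [|y a IH] x P.
  by rewrite /= big_seq1 big_cons big_nil addr0.
rewrite [in RHS]big_mkcond.
rewrite !(big_decs_cons _ x (y :: a)) !big_split /=.
rewrite !(IH y) /= add0r [in LHS]addrCA; congr (_ + (_ + _ + _)).
  by apply: eq_bigr => -[|? []].
by apply: eq_bigr => -[|? []].
Qed.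
End Decompositions.

Lemma cuts_map (T S : Type) (f : T -> S) a :
  cuts (map f a) = [seq (map f c.1, map f c.2) | c <- cuts a].
Proof. by elim: a => //= x a ->; rewrite -!map_comp. Qed.

Lemma decs_map (T S : Type) (f : T -> S) a :
  decs (map f a) = map (map (map f)) (decs a).
Proof.
elim: a => //= x a ->; rewrite map_cat -!map_comp; congr (_ ++ _).
by elim: (decs a) => //= -[|b bs] s /= IH; rewrite IH.
Qed.

(** * Characterization of cuts and decompositions by concatenation *)

Section Membership.
Context {T : eqType}.
Implicit Types (a : seq T) (bs : seq (seq T)).

Lemma mem_cuts a (c : seq T * seq T) : (c \in cuts a) = (c.1 ++ c.2 == a).
Proof.
elim: a c => [|x a IH] [u v] /=.
  by rewrite inE xpair_eqE; case: u v => [|??] [|??].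
rewrite inE xpair_eqE; case: u => [|y u] /=.
  by apply: orb_idr; case/mapP.
rewrite eqseq_cons -(IH (u, v)).
apply/mapP/andP => [[[u' v'] /= ? [-> -> ->]]|[/eqP-> uv]] //.
by exists (u, v).
Qed.

Lemma mem_decs a bs : (bs \in decs a) = (flatten bs == a) && ([::] \notin bs).
Proof.
elim: a bs => [|x a IH] bs /=.
  by rewrite inE; case: bs => [|[|? ?] bs] /=; rewrite ?inE ?andbF.
rewrite mem_cat; apply/orP/idP => [[/mapP[cs]|/mapP[cs]]|].
- by rewrite IH => /andP[/eqP<- ?] -> /=; rewrite eqxx inE.
- rewrite mem_filter IH; case: cs => [|b cs] //= /andP[/eqP <-].
  by rewrite in_cons => /norP[_ ?] ->; rewrite /= eqxx in_cons.
case: bs => [|[|y b] bs] //; first by rewrite in_cons andbF.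
rewrite in_cons /= eqseq_cons; case: b => [|z b] /andP[/andP[/eqP-> fl] ne].
  by left; apply/mapP; exists bs; rewrite // IH fl.
right; apply/mapP; exists ((z :: b) :: bs); rewrite // mem_filter IH /=.
by rewrite in_cons fl.
Qed.

Lemma decs_uniq a : uniq (decs a).
Proof.
elim: a => //= x a IH; rewrite cat_uniq map_inj_uniq ?IH; last by move=> ? ? [].
rewrite /=; apply/andP; split.
  apply/hasPn => cs /mapP[bs]; rewrite mem_filter mem_decs => /and3P[bs0 _ ne] ->.
  by case: bs bs0 ne => [|[|y b] bs] // _ _; apply/mapP=> -[].
rewrite map_inj_in_uniq ?filter_uniq //.
by move=> [|b bs] [|b' bs']; rewrite !mem_filter //= => _ _ [-> ->].
Qed.

Lemma size_decs_le a bs : bs \in decs a -> (size bs <= size a)%N.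
Proof.
rewrite mem_decs => /andP[/eqP <-]; elim: bs => //= -[|x b] bs IH //.
rewrite inE => /IH {}IH; rewrite size_cat addSn ltnS (leq_trans IH) ?leq_addl //.
Qed.

(** Some other block is present and nonempty. This makes the recursion for phi well-founded. *)
Lemma size_block_lt a bs b :
  bs \in decs a -> (1 < size bs)%N -> b \in bs -> (size b < size a)%N.
Proof.
rewrite mem_decs => /andP[/eqP <- ne] s_bs b_bs.
case/splitPr: b_bs s_bs ne => L R; rewrite mem_cat in_cons size_cat => s_bs ne.
rewrite flatten_cat !size_cat addnCA -addn1 leq_add2l.
case: L s_bs ne => [|[|? ?] L] //.
by case: R => [|[|? ?] R] //; rewrite !in_cons orbT.
Qed.

Lemma block_subset a bs b : bs \in decs a -> b \in bs -> {subset b <= a}.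
Proof.
rewrite mem_decs => /andP[/eqP <- _] b_bs x xb; apply/flattenP.
by exists b.
Qed.
End Membership.

(** [shape] and [reshape] are inverse bijections between decompositions and tuples of positive block
    sizes with the right sum. *)
Lemma composition_sumE (R : comPzRingType) (V W : lmodType R)
    (m : seq W -> W) (phi : seq V -> W) (a : seq V) :
  composition_sum m phi a = \sum_(bs <- decs a) m (map phi bs).
Proof.
pose n := (size a).+1; pose G bs := m (map phi bs).
pose good j (c : j.-tuple 'I_n) :=
  all (fun x : 'I_n => 0 < x)%N c && (sumn (map val c) == size a).
(* Sort by the number of blocks, which is at most [size a] as blocks are nonempty. *)
have -> : \sum_(bs <- decs a) G bs =
    \sum_(j < n) \sum_(bs <- decs a | size bs == j) G bs.
  under [RHS]eq_bigr => j _ do rewrite big_mkcond.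
  rewrite exchange_big; apply: eq_big_seq => bs /size_decs_le bs_le /=.
  rewrite -big_mkcond (big_pred1 (Ordinal (bs_le : size bs < n)%N)) => //.
apply: eq_bigr => j _.
pose resh (c : j.-tuple 'I_n) := reshape (map val c) a.
have resh_shape c : good j c -> shape (resh c) = map val c.
  by case/andP => _ /eqP sc; rewrite reshapeKl ?sc.
transitivity (\sum_(bs <- map resh (filter (good j) (enum {: j.-tuple 'I_n}))) G bs).
  by rewrite big_map big_filter big_enum_cond.
rewrite -[RHS]big_filter; apply/perm_big/uniq_perm.
- rewrite map_inj_in_uniq; first by rewrite filter_uniq // enum_uniq.
  move=> c c'.
  rewrite !mem_filter => /andP[gc _] /andP[gc' _] /(congr1 shape).
  by rewrite !resh_shape // => /(inj_map val_inj)/val_inj.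
- by rewrite filter_uniq ?decs_uniq.
move=> bs; rewrite mem_filter mem_decs; apply/mapP/and3P => [[c]|].
  rewrite mem_filter => /andP[gc _] ->; have := resh_shape c gc.
  case/andP: gc => c0 /eqP sc shE; split.
  - by rewrite -(size_map size) -/(shape _) shE size_map size_tuple.
  - by rewrite reshapeKr ?sc.
  apply/negP => ne; have : 0%N \in shape (resh c) by apply/mapP; exists [::].
  by rewrite shE => /mapP[k /(allP c0) + k0]; rewrite -k0.
case=> /eqP s_bs /eqP fl ne.
(* No block is longer than the word, so [inord] below preserves its size. *)
have lt k : k \in shape bs -> (k < n)%N.
  case/mapP=> b b_bs ->; rewrite ltnS -fl size_flatten.
  by rewrite sumnE big_map (big_rem b) //= leq_addr.
have sz : size (map (inord : nat -> 'I_n) (shape bs)) == j.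
  by rewrite !size_map s_bs.
have valE : map val (Tuple sz) = shape bs.
  rewrite /= -map_comp -[RHS]map_id; apply/eq_in_map => k /lt lt_k /=.
  by rewrite inordK.
exists (Tuple sz); last by rewrite /resh valE -fl flattenK.
rewrite mem_filter mem_enum andbT /good valE -size_flatten fl eqxx andbT.
rewrite -(all_map val (fun k : nat => 0 < k)%N) valE all_map; apply/allP => b b_bs /=.
by case: b b_bs ne => // ->.
Qed.

(** * Signed insertions *)

Section Multilinear.
Context {R : comPzRingType} {V W : lmodType R} {f : seq V -> W}.
Hypothesis f_lin : multilinear f.

Lemma multilinearD s t x y : f (s ++ (x + y) :: t) = f (s ++ x :: t) + f (s ++ y :: t).
Proof. by have := f_lin s t 1 x y; rewrite /= !scale1r. Qed.

Lemma multilinear0 s t : f (s ++ 0 :: t) = 0.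
Proof. by apply: (addrI (f (s ++ 0 :: t))); rewrite -multilinearD !addr0. Qed.

Lemma multilinearZ s t c x : f (s ++ (c *: x) :: t) = c *: f (s ++ x :: t).
Proof. by have := f_lin s t c x 0; rewrite /= !addr0 multilinear0 addr0. Qed.

Lemma multilinearN s t x : f (s ++ (- x) :: t) = - f (s ++ x :: t).
Proof. by rewrite -scaleN1r multilinearZ scaleN1r. Qed.

Lemma multilinear_sum s t I (r : seq I) (F : I -> V) :
  f (s ++ (\sum_(k <- r) F k) :: t) = \sum_(k <- r) f (s ++ F k :: t).
Proof.
elim: r => [|k r IH]; first by rewrite !big_nil multilinear0.
by rewrite !big_cons multilinearD IH.
Qed.

End Multilinear.

(** * Homogeneous elements and signs *)

Section GradedPieces.
Context {R : comPzRingType} {A : gradedModule R}.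

Lemma piece_sum d (I : eqType) (r : seq I) (P : pred I) (F : I -> A) :
  (forall k, k \in r -> P k -> piece d (F k)) -> piece d (\sum_(k <- r | P k) F k).
Proof.
move=> pF; rewrite big_seq_cond; elim/big_ind: _ => [|x y px py|k /andP[]].
- exact: piece0.
- by rewrite -[x]scale1r; apply: pieceP.
exact: pF.
Qed.

Lemma homogeneous_unzip (z : seq (A * int)) :
  homogeneous (unzip2 z) (unzip1 z) <-> {in z, forall x, piece x.2 x.1}.
Proof.
split=> [[_ hz] x /(nthP (0, 0)) [k lt_k <-]|hz].
  by have := hz k; rewrite size_map !(nth_map (0, 0)) //; apply.
split; first by rewrite !size_map.
move=> k; rewrite size_map => lt_k; rewrite !(nth_map (0, 0)) //.
by apply: hz; rewrite mem_nth.
Qed.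

Lemma homogeneous_zip (d : seq int) (a : seq A) : homogeneous d a ->
  exists z, [/\ d = unzip2 z, a = unzip1 z & {in z, forall x, piece x.2 x.1}].
Proof.
move=> hd; have [sd _] := hd; exists (zip a d).
have z1 : unzip1 (zip a d) = a by rewrite unzip1_zip ?sd.
have z2 : unzip2 (zip a d) = d by rewrite unzip2_zip ?sd.
by split=> //; apply/homogeneous_unzip; rewrite z1 z2.
Qed.
End GradedPieces.

Lemma sdeg_cat d e : sdeg (d ++ e) = sdeg d + sdeg e.
Proof. by rewrite /sdeg big_cat. Qed.

(* Elements are paired with their degrees, so that signs follow the
   sequence when it is cut. *)
Definition shift_sign (R : pzRingType) (V : Type) (u : seq (V * int)) : R :=
  (-1) ^+ `|sdeg (unzip2 u)|%N.

Lemma shift_sign_nil (R : pzRingType) (V : Type) :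
  shift_sign R ([::] : seq (V * int)) = 1.
Proof. by rewrite /shift_sign /sdeg big_nil. Qed.

(** Absolute values of integers are not additive, but their parities are, and the sign sees only
    parity. *)
Lemma shift_sign_cat (R : pzRingType) (V : Type) (u v : seq (V * int)) :
  shift_sign R (u ++ v) = shift_sign R u * shift_sign R v.
Proof.
rewrite /shift_sign /unzip2 map_cat sdeg_cat -exprD.
rewrite -[LHS]signr_odd -[RHS]signr_odd; congr (_ ^+ _).
lia.
Qed.

Section Insertion.
Context {R : comPzRingType} {V : lmodType R}.
Local Notation sgn := (shift_sign R).

Definition insertion (W : lmodType R) (f : seq V -> W) (g : seq V -> V)
    (z : seq (V * int)) : W :=
  \sum_(c <- cuts z) \sum_(e <- cuts c.2)
    sgn c.1 *: f (unzip1 c.1 ++ g (unzip1 e.1) :: unzip1 e.2).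

Lemma insertion_sumE (W : lmodType R) (f : seq V -> W) g z :
  insertion_sum f g (unzip2 z) (unzip1 z) = insertion f g z.
Proof.
rewrite /insertion (big_cuts_take_drop (fun u v => \sum_(e <- cuts v)
  sgn u *: f (unzip1 u ++ g (unzip1 e.1) :: unzip1 e.2))).
rewrite /insertion_sum size_map; apply: eq_bigr => r _.
rewrite (big_cuts_take_drop (fun v w =>
  sgn (take r z) *: f (unzip1 (take r z) ++ g (unzip1 v) :: unzip1 w))).
rewrite size_drop; apply: eq_bigr => s _.
by rewrite /shift_sign /unzip1 /unzip2 !map_take !map_drop drop_drop addnC.
Qed.

Lemma insertion1 (W : lmodType R) (f : seq V -> W) g v d :
  insertion f g [:: (v, d)] =
  f [:: g [::]; v] + f [:: g [:: v]] + sgn [:: (v, d)] *: f [:: v; g [::]].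
Proof.
rewrite /insertion /= big_cons !big_seq1 /= big_cons big_seq1 /=.
by rewrite !shift_sign_nil !scale1r.
Qed.

(** The inserted value always occupies one slot, so [f] is never evaluated at the empty word. *)
Lemma insertion_ext (W : lmodType R) (f f' : seq V -> W) g z :
  (forall a, (0 < size a)%N -> f a = f' a) -> insertion f g z = insertion f' g z.
Proof.
move=> ff'; apply: eq_bigr => c _; apply: eq_bigr => e _.
by rewrite ff' // size_cat addnS.
Qed.

Lemma insertionD (W : lmodType R) (f f' : seq V -> W) g z :
  insertion (fun a => f a + f' a) g z = insertion f g z + insertion f' g z.
Proof.
rewrite -big_split; apply: eq_bigr => c _; rewrite -big_split.
by apply: eq_bigr => e _; rewrite /= scalerDr.
Qed.

Lemma insertion_linear (W U : lmodType R) (h : {linear W -> U}) (f : seq V -> W) g z :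
  insertion (fun a => h (f a)) g z = h (insertion f g z).
Proof.
rewrite /insertion linear_sum; apply: eq_bigr => c _; rewrite linear_sum.
by apply: eq_bigr => e _; rewrite linearZ.
Qed.

Lemma insertion_multilinear (W U : lmodType R) (h : seq W -> U) (f : seq V -> W) g s t z :
  multilinear h ->
  insertion (fun a => h (s ++ f a :: t)) g z = h (s ++ insertion f g z :: t).
Proof.
move=> h_lin; rewrite /insertion multilinear_sum //; apply: eq_bigr => c _.
by rewrite multilinear_sum //; apply: eq_bigr => e _; rewrite multilinearZ.
Qed.
End Insertion.

(** Meant for induction on length: once proper middle factors contribute zero, only the whole word
    remains. *)
Lemma big_cuts_full T (U : zmodType) (P : seq T -> seq T -> seq T -> U) z :
    (forall u v w, u ++ v ++ w = z -> (size v < size z)%N -> P u v w = 0) ->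
  \sum_(c <- cuts z) \sum_(e <- cuts c.2) P c.1 e.1 e.2 = P [::] z [::].
Proof.
move=> P0.
pose Q u v := \sum_(e <- cuts v) P u e.1 e.2.
rewrite (big_cuts_take_drop Q) big_ord_recl big1 ?addr0 => [|r _]; last first.
  rewrite /Q (big_cuts_take_drop (P _)) big1 // => s _; apply: P0.
    by rewrite !cat_take_drop.
  rewrite size_take_min (leq_ltn_trans (geq_minr _ _)) // size_drop /=.
  by rewrite ltn_subrL (leq_trans _ (ltn_ord r)).
rewrite take0 drop0 /Q (big_cuts_take_drop (P _)) big_ord_recr big1 => [|r _].
  by rewrite /= add0r take_size drop_size.
apply: P0; first by rewrite cat_take_drop.
by rewrite size_take_min (leq_ltn_trans (geq_minl _ _) (ltn_ord r)).
Qed.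

(** * The bar relation *)

(** [predT] gives m phi; the predicate [1 < n] used later gives m' phi without the m_0 term, which
    could occur only at the empty word. *)
Definition block_sum (R : comPzRingType) (V W : lmodType R) (q : pred nat)
    (m : seq W -> W) (phi : seq V -> W) (a : seq V) : W :=
  \sum_(bs <- decs a | q (size bs)) m (map phi bs).

(** phi preserves shifted degree; the [+ 1] converts it back to the unshifted degree stored in the
    pair. *)
Definition lift_degree (V W : Type) (phi : seq V -> W) (b : seq (V * int)) : W * int :=
  (phi (unzip1 b), sdeg (unzip2 b) + 1).

Section BlockSums.
Context {R : comPzRingType} {V A : gradedModule R}.
Context {m : curvedAinf A} {phi : seq V -> A}.
Hypotheses (phi_lin : multilinear phi) (phi_deg : shifted_degree 0 phi).
Local Notation sgn := (shift_sign R).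
Local Notation apply_blocks := (map (fun b : seq (V * int) => phi (unzip1 b))).
Let m_lin := @ainf_multilinear R A m.

Lemma unzip1_lift_degree (bs : seq (seq (V * int))) :
  unzip1 (map (lift_degree phi) bs) = apply_blocks bs.
Proof. by rewrite /unzip1 -map_comp. Qed.

Lemma sdeg_lift_degree (bs : seq (seq (V * int))) :
  sdeg (unzip2 (map (lift_degree phi) bs)) = sdeg (unzip2 (flatten bs)).
Proof.
elim: bs => [|b bs IH] //=; rewrite /unzip2 map_cat sdeg_cat -IH.
by rewrite /sdeg big_cons addrK.
Qed.

Lemma lift_degree_homogeneous z bs :
  {in z, forall x : V * int, piece x.2 x.1} -> bs \in decs z ->
  {in map (lift_degree phi) bs, forall x, piece x.2 x.1}.
Proof.
move=> hz bsz _ /mapP[b b_bs ->] /=; rewrite -[sdeg _]addr0.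
apply/phi_deg/homogeneous_unzip => x /(block_subset bsz b_bs); exact: hz.
Qed.

Lemma block_sum_unzip q z :
  block_sum q m phi (unzip1 z) = \sum_(bs <- decs z | q (size bs)) m (apply_blocks bs).
Proof.
rewrite /block_sum decs_map big_map.
by apply: eq_big => [bs|bs _]; rewrite ?size_map // -map_comp.
Qed.

(** A given entry lies in exactly one block, and both [phi] and [m] are linear there. *)
Lemma block_sum_linear q : multilinear (block_sum q m phi).
Proof.
move=> s t k x y; rewrite /block_sum.
rewrite !(big_mkcond (fun bs => q (size bs)) (fun bs => m (map phi bs))) !big_decs_mid.
rewrite scaler_sumr -big_split; apply: eq_bigr => c _ /=.
rewrite scaler_sumr -big_split; apply: eq_bigr => e _ /=.
rewrite scaler_sumr -big_split; apply: eq_bigr => L _ /=.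
rewrite scaler_sumr -big_split; apply: eq_bigr => K _ /=.
rewrite !size_cat /=; case: ifP => _; last by rewrite scaler0 addr0.
rewrite !map_cat /= -(multilinearZ m_lin) -(multilinearD m_lin).
by congr (m (_ ++ _ :: _)); apply: phi_lin.
Qed.

Lemma block_sum_degree q : shifted_degree 1 (block_sum q m phi).
Proof.
move=> _ _ /homogeneous_zip[z [-> -> hz]]; rewrite block_sum_unzip.
apply: piece_sum => bs bsz _.
have [/eqP fl _] := andP (etrans (esym (mem_decs z bs)) bsz).
rewrite -[in sdeg _]fl -sdeg_lift_degree -unzip1_lift_degree.
by apply/ainf_degree/homogeneous_unzip/(lift_degree_homogeneous hz bsz).
Qed.

(** This is m m phi = 0: the relations of [m] at the images of the blocks, summed over
    decompositions and regrouped by the subword fed to the inner [m]. Signs agree because [phi] has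
    shifted degree zero. *)
Lemma bar_relation z : {in z, forall x : V * int, piece x.2 x.1} ->
  \sum_(c <- cuts z) \sum_(e <- cuts c.2) sgn c.1 *:
    \sum_(L <- decs c.1) \sum_(K <- decs e.2)
      m (apply_blocks L ++ block_sum predT m phi (unzip1 e.1) :: apply_blocks K) = 0.
Proof.
move=> hz.
have : \sum_(bs <- decs z) insertion m m (map (lift_degree phi) bs) = 0.
  apply: big1_seq => bs /andP[_ bsz]; rewrite -insertion_sumE.
  by apply/ainf_rel/homogeneous_unzip/(lift_degree_homogeneous hz bsz).
pose P L B K := sgn (map (lift_degree phi) L) *:
  m (apply_blocks L ++ m (apply_blocks B) :: apply_blocks K).
have -> : \sum_(bs <- decs z) insertion m m (map (lift_degree phi) bs) =
    \sum_(bs <- decs z) \sum_(c <- cuts bs) \sum_(e <- cuts c.2) P c.1 e.1 e.2.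
  apply: eq_bigr => bs _; rewrite /insertion cuts_map big_map; apply: eq_bigr => c _ /=.
  rewrite cuts_map big_map; apply: eq_bigr => e _ /=.
  by rewrite !unzip1_lift_degree.
rewrite (big_cuts_decs (fun L B => \sum_(e <- cuts B) P L e.1 e.2)) => bar0.
rewrite -[RHS]bar0.
apply: eq_bigr => c _; under [RHS]eq_bigr do rewrite (big_cuts_decs (P _)).
rewrite exchange_big; apply: eq_bigr => e _ /=.
rewrite scaler_sumr; apply: eq_big_seq => L Lc.
have [/eqP fl _] := andP (etrans (esym (mem_decs c.1 L)) Lc).
rewrite exchange_big scaler_sumr; apply: eq_bigr => K _ /=.
rewrite block_sum_unzip multilinear_sum // scaler_sumr; apply: eq_bigr => B _.
by rewrite /P {2}/shift_sign sdeg_lift_degree fl.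
Qed.

(** The inserted [g] falls into exactly one block, where it forms an insertion into [phi]; the other
    blocks are untouched. *)
Lemma insertion_block_sum (g : seq V -> V) z :
  insertion (block_sum predT m phi) g z =
  \sum_(c <- cuts z) \sum_(e <- cuts c.2) sgn c.1 *:
    \sum_(L <- decs c.1) \sum_(K <- decs e.2)
      m (apply_blocks L ++ insertion phi g e.1 :: apply_blocks K).
Proof.
(* The word is read as u1 u2 x w1 w2: [g] consumes x, and its block covers u2 x w1. The sign of the
   prefix u1 u2 factors accordingly. *)
pose Q u1 u2 (x w1 : seq (V * int)) w2 := sgn u1 *: (sgn u2 *:
  \sum_(L <- decs u1) \sum_(K <- decs w2)
    m (apply_blocks L ++ phi (unzip1 u2 ++ g (unzip1 x) :: unzip1 w1) :: apply_blocks K)).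
transitivity (\sum_(c <- cuts z) \sum_(c' <- cuts c.1)
    \sum_(e <- cuts c.2) \sum_(e' <- cuts e.2) Q c'.1 c'.2 e.1 e'.1 e'.2).
  apply: eq_bigr => c _; rewrite exchange_big; apply: eq_bigr => e _ /=.
  rewrite /block_sum big_decs_mid cuts_map big_map scaler_sumr.
  apply: eq_big_seq => -[u1 u2]; rewrite mem_cuts => /eqP /= <-.
  rewrite cuts_map big_map scaler_sumr; apply: eq_bigr => e' _ /=.
  rewrite decs_map big_map /Q scalerA -shift_sign_cat; congr (_ *: _).
  apply: eq_bigr => L _; rewrite decs_map big_map; apply: eq_bigr => K _ /=.
  by rewrite map_cat /= -!map_comp.
(* Repeated coassociativity brackets u2 x w1 as a single subword. *)
rewrite (big_cuts_coassoc (fun u1 u2 v =>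
  \sum_(e <- cuts v) \sum_(e' <- cuts e.2) Q u1 u2 e.1 e'.1 e'.2)).
apply: eq_bigr => c _.
under eq_bigr => c' _ do rewrite -(big_cuts_coassoc (Q c.1 c'.1)).
rewrite -(big_cuts_coassoc (fun u2 v w2 => \sum_(e' <- cuts v) Q c.1 u2 e'.1 e'.2 w2)).
apply: eq_bigr => c' _.
transitivity (\sum_(e <- cuts c'.1) sgn c.1 *: \sum_(L <- decs c.1) \sum_(K <- decs c'.2)
   m (apply_blocks L ++ (\sum_(e' <- cuts e.2)
     sgn e.1 *: phi (unzip1 e.1 ++ g (unzip1 e'.1) :: unzip1 e'.2)) :: apply_blocks K)).
  apply: eq_bigr => e _; rewrite /Q -scaler_sumr; congr (_ *: _).
  under eq_bigr do rewrite scaler_sumr.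
  rewrite exchange_big; apply: eq_bigr => L _ /=.
  under eq_bigr do rewrite scaler_sumr.
  rewrite exchange_big; apply: eq_bigr => K _ /=.
  by rewrite multilinear_sum //; apply: eq_bigr => e' _; rewrite multilinearZ.
rewrite -scaler_sumr; congr (_ *: _); rewrite exchange_big; apply: eq_bigr => L _ /=.
by rewrite exchange_big; apply: eq_bigr => K _ /=; rewrite [in RHS]multilinear_sum.
Qed.

(** For arbitrary [g], put E = m phi - phi g. Replacing phi g by m phi - E in the previous formula
    leaves m m phi = 0 minus the terms with E. *)
Lemma insertion_block_sum_defect (g : seq V -> V) z :
    {in z, forall x : V * int, piece x.2 x.1} ->
  insertion (block_sum predT m phi) g z =
  - \sum_(c <- cuts z) \sum_(e <- cuts c.2) sgn c.1 *:
    \sum_(L <- decs c.1) \sum_(K <- decs e.2)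
      m (apply_blocks L ++
         (block_sum predT m phi (unzip1 e.1) - insertion phi g e.1) :: apply_blocks K).
Proof.
move=> hz; apply/eqP; rewrite -addr_eq0; apply/eqP.
rewrite insertion_block_sum -[RHS](bar_relation hz) -big_split.
apply: eq_bigr => c _; rewrite -big_split; apply: eq_bigr => e _ /=.
rewrite -scalerDr -big_split; congr (_ *: _); apply: eq_bigr => L _ /=.
rewrite -big_split.
by apply: eq_bigr => K _; rewrite /= -(multilinearD m_lin) addrC subrK.
Qed.

End BlockSums.

(** * The transferred structure *)

Section Transfer.
Context {R : comPzRingType} {A V : gradedModule R} (m : curvedAinf A).
Context (i : {linear V -> A}) (p : {linear A -> V}) (H : {linear A -> A}) (C : V).
Let m_lin := @ainf_multilinear R A m.
Local Notation inner phi := (block_sum (fun n => 1 < n)%N m phi).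

(** The equation phi = i + H m' phi calls phi on blocks, which are not structural subterms, so the
    recursion is on a bound [k] for the length. *)
Fixpoint transfer_approx k (a : seq V) : A :=
  if k is k'.+1 then
    if a is [:: x] then i x else H (inner (transfer_approx k') a)
  else 0.

Definition transfer_hom a := transfer_approx (size a) a.

Definition transfer_op (a : seq V) : V :=
  if a is [::] then C else p (block_sum predT m transfer_hom a).

Lemma eq_inner (f g : seq V -> A) a :
  (forall b, (size b < size a)%N -> f b = g b) -> inner f a = inner g a.
Proof.
move=> fg; rewrite /block_sum big_seq_cond [RHS]big_seq_cond.
apply: eq_bigr => bs /andP[bsa bs1]; congr (m _); apply/eq_in_map => b b_bs.
exact/fg/(size_block_lt bsa).
Qed.

Lemma inner_small (f : seq V -> A) a : (size a <= 1)%N -> inner f a = 0.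
Proof.
move=> a1; rewrite /block_sum big_seq_cond big1 // => bs /andP[/size_decs_le bsa].
by rewrite ltnNge (leq_trans bsa a1).
Qed.

Lemma transfer_approx_stable k a :
  (size a <= k)%N -> transfer_approx k a = transfer_hom a.
Proof.
rewrite /transfer_hom; have [n] := ubnP (size a); elim: n => // n IH in k a *.
case: a k => [|x [|y a]] [|k] //= a_n a_k; first by rewrite inner_small ?linear0.
congr (H _); apply: eq_inner => b b_a; rewrite /= in b_a.
rewrite (IH k); [symmetry; apply: (IH (size a).+1)| |]; lia.
Qed.

Lemma transfer_hom1 x : transfer_hom [:: x] = i x.
Proof. by []. Qed.

Lemma transfer_homE a :
  transfer_hom a = H (inner transfer_hom a) + (if a is [:: x] then i x else 0).
Proof.
case: a => [|x [|y a]]; first by rewrite inner_small // linear0 addr0.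
  by rewrite inner_small // linear0 add0r.
rewrite addr0 {1}/transfer_hom /=; congr (H _); apply: eq_inner => b b_a.
exact: (@transfer_approx_stable (size a).+1).
Qed.

Lemma transfer_approx_linear k : multilinear (transfer_approx k).
Proof.
elim: k => [|k IH] s t c x y; first by rewrite /= scaler0 addr0.
have := block_sum_linear IH (fun n => 1 < n)%N s t c x y.
move=> /= E; case: s t E => [|u [|v s]] [|w t] E; rewrite /= ?linearP //=.
all: by rewrite [X in H X]E linearP.
Qed.

Lemma transfer_hom_linear : multilinear transfer_hom.
Proof.
move=> s t c x y; rewrite /transfer_hom !size_cat /=.
exact: transfer_approx_linear.
Qed.

Lemma transfer_op_linear : multilinear transfer_op.
Proof.
move=> s t c x y; have := block_sum_linear transfer_hom_linear predT s t c x y.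
by move=> /= E; case: s E => [|u s] /= E; rewrite [X in p X]E linearP.
Qed.

Lemma full_block_sumE (phi : seq V -> A) a : (0 < size a)%N ->
  block_sum predT m phi a = inner phi a + m [:: phi a].
Proof. by move=> a0; rewrite /block_sum big_decs_split1 // addrC. Qed.

Hypotheses (i_deg : map_degree 0 i) (p_deg : map_degree 0 p) (H_deg : map_degree (-1) H).
Hypothesis (C_deg : piece 2 C).

Lemma transfer_approx_degree k : shifted_degree 0 (transfer_approx k).
Proof.
elim: k => [|k IH] d a hda; first exact: piece0.
have Hd : piece (sdeg d + 0 + 1) (H (inner (transfer_approx k) a)).
  have -> : sdeg d + 0 + 1 = sdeg d + 1 + 1 + (-1) by ring.
  exact/H_deg/block_sum_degree.
case: a hda Hd => [|x [|y a]] hda //= _.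
case: hda; case: d => [|e [|e' d]] // _ /(_ 0%N isT) /= ex.
by rewrite /sdeg big_seq1 addr0 subrK -[e]addr0; apply: i_deg.
Qed.

Lemma transfer_hom_degree : shifted_degree 0 transfer_hom.
Proof. move=> d a; exact: transfer_approx_degree. Qed.

Lemma transfer_op_degree : shifted_degree 1 transfer_op.
Proof.
move=> d a hda; case: a hda => [|x a] hda.
  by case: hda; case: d => // _ _; rewrite /sdeg big_nil.
rewrite -[_ + 1]addr0; apply/p_deg/block_sum_degree => //; exact: transfer_hom_degree.
Qed.

Hypotheses (iC : i C = m [::])
  (homotopy : forall a : A,
     m [:: H a] + H (m [:: a]) = i (p a) - a - H (m [:: m [:: H a]]))
  (pmH : forall a : A, p (m [:: H a]) = 0)
  (Hmi : forall v : V, H (m [:: i v]) = 0).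

Local Notation mD := (multilinearD m_lin [::] [::]).
Local Notation mN := (multilinearN m_lin [::] [::]).

Lemma insertion_single (g : seq V -> V) z :
  insertion (fun a => if a is [:: x] then i x else 0) g z = i (g (unzip1 z)).
Proof.
rewrite /insertion (big_cuts_full (P := fun u v w => shift_sign R u *:
  (if unzip1 u ++ g (unzip1 v) :: unzip1 w is [:: x] then i x else 0))).
  by rewrite shift_sign_nil scale1r.
case=> [|x [|y u]] v w <-; rewrite ?scaler0 //.
by case: w => [|y w]; rewrite ?scaler0 // cats0 ltnn.
Qed.

Lemma transfer_relation1 v d : piece d v ->
  block_sum predT m transfer_hom [:: v] = insertion transfer_hom transfer_op [:: (v, d)].
Proof.
move=> dv; set w := [:: (v, d)].
have hom2 x y : transfer_hom [:: x; y] = H (m [:: i x; i y]).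
  by rewrite transfer_homE addr0 /block_sum /= !big_cons big_nil /= addr0.
have mu1 : transfer_op [:: v] = p (m [:: i v]) by rewrite /= /block_sum big_seq1.
have rel : insertion m m [:: (i v, d)] = 0.
  rewrite -insertion_sumE; apply/ainf_rel/homogeneous_unzip => x.
  by rewrite inE => /eqP ->; rewrite -[d]addr0; apply: i_deg.
have relH : insertion transfer_hom transfer_op w =
    i (p (m [:: i v])) - H (m [:: m [:: i v]]).
  move/eqP: rel; rewrite insertion1 addrAC addr_eq0 => /eqP /(congr1 H).
  rewrite linearD linearZ linearN => <-.
  by rewrite insertion1 !hom2 iC mu1 transfer_hom1 addrAC addrC.
have := homotopy (m [:: i v]).
rewrite Hmi !(multilinear0 m_lin [::] [::]).
rewrite linear0 add0r subr0 relH => ->; rewrite opprB addrC subrK.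
by rewrite /block_sum big_seq1.
Qed.

Lemma transfer_relation z : {in z, forall x : V * int, piece x.2 x.1} ->
  block_sum predT m transfer_hom (unzip1 z) = insertion transfer_hom transfer_op z.
Proof.
have [n] := ubnP (size z); elim: n => // n IH in z *.
case: z => [|[v d] [|y z]] z_n hz.
- by rewrite /block_sum /insertion !big_seq1 shift_sign_nil scale1r transfer_hom1.
- by apply/transfer_relation1/(hz (v, d)); rewrite inE.
set w := [:: (v, d), y & z] in z_n hz *.
set b := inner transfer_hom (unzip1 w).
set X := H (insertion (inner transfer_hom) transfer_op w).
have phiE : transfer_hom (unzip1 w) = H b by rewrite transfer_homE addr0.
have muE : transfer_op (unzip1 w) = p b.
  by rewrite -[LHS]/(p _) full_block_sumE // phiE linearD pmH addr0.
have insE : insertion transfer_hom transfer_op w = X + i (p b).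
  rewrite -muE -insertion_single /X -insertion_linear -insertionD.
  by apply: insertion_ext => a _; apply: transfer_homE.
rewrite full_block_sumE // phiE -/b insE; apply/eqP; rewrite -subr_eq0; apply/eqP.
set E := b + _ - _.
have XE : X + H (m [:: X]) = - H (m [:: E]).
  have := insertion_block_sum_defect (m := m) transfer_hom_degree transfer_op hz.
  rewrite (big_cuts_full (P := fun u v w => shift_sign R u *:
    \sum_(L <- decs u) \sum_(K <- decs w) m (map (fun b => transfer_hom (unzip1 b)) L ++
      (block_sum predT m transfer_hom (unzip1 v) - insertion transfer_hom transfer_op v)
      :: map (fun b => transfer_hom (unzip1 b)) K))); last first.
    move=> u x u' uxu' x_w; rewrite IH ?subrr.
    - rewrite big1 ?scaler0 // => L _; rewrite big1 // => K _.
      by rewrite multilinear0.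
    - by rewrite (leq_trans x_w).
    by move=> t tx; apply: hz; rewrite -uxu' !mem_cat tx orbT.
  rewrite shift_sign_nil scale1r !big_seq1 /= insE full_block_sumE // phiE -/b -/E.
  rewrite (insertion_ext (f' := fun a =>
    inner transfer_hom a + m [:: transfer_hom a])); last first.
    exact: full_block_sumE.
  rewrite insertionD => /(congr1 H); rewrite linearN linearD -/X => <-; congr (_ + _).
  rewrite (insertion_multilinear _ _ [::] [::] _ m_lin) insE.
  by rewrite mD linearD Hmi addr0.
have HmE : H (m [:: E]) = H (m [:: b]) + H (m [:: m [:: H b]]) - H (m [:: X]).
  by rewrite /E opprD addrA !mD !mN !linearD !linearN Hmi subr0.
have {HmE}XE : X = - (H (m [:: b]) + H (m [:: m [:: H b]])).
  by apply: (addIr (H (m [:: X]))); rewrite XE HmE opprB addrC.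
apply/eqP; rewrite /E subr_eq0 -[m [:: H b]](addrK (H (m [:: b]))) homotopy XE.
by rewrite -!addrA addrCA addNKr addrC opprD [- _ - _]addrC.
Qed.

Lemma transfer_op_relation z : {in z, forall x : V * int, piece x.2 x.1} ->
  insertion transfer_op transfer_op z = 0.
Proof.
move=> hz.
rewrite (insertion_ext (f' := fun a => p (block_sum predT m transfer_hom a))).
  2: by case.
rewrite insertion_linear.
rewrite (insertion_block_sum_defect transfer_hom_degree) //.
rewrite big_seq big1 ?oppr0 ?linear0 // => c; rewrite mem_cuts => /eqP cz.
rewrite big_seq big1 // => e; rewrite mem_cuts => /eqP ec.
rewrite transfer_relation ?subrr => [|x xe].
  rewrite big1 ?scaler0 // => L _; rewrite big1 // => K _.
  by rewrite multilinear0.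
by apply: hz; rewrite -cz -ec !mem_cat xe orbT.
Qed.
End Transfer.

Theorem theorem3p1 (R : comPzRingType) (A V : gradedModule R)
  (m : curvedAinf A)
  (i : {linear V -> A}) (p : {linear A -> V}) (H : {linear A -> A})
  (i_deg : map_degree 0 i) (p_deg : map_degree 0 p) (H_deg : map_degree (-1) H)
  (C : V) (C_deg : piece 2 C) (iC : i C = m [::])
  (homotopy : forall a : A,
     m [:: H a] + H (m [:: a]) = i (p a) - a - H (m [:: m [:: H a]]))
  (pmH : forall a : A, p (m [:: H a]) = 0)
  (Hmi : forall v : V, H (m [:: i v]) = 0) :
  exists mu : curvedAinf V,
    [/\ mu [::] = C,
        forall v : V, mu [:: v] = p (m [:: i v])
      & exists phi : ainfHom mu m, forall v : V, phi [:: v] = i v].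
Proof.
pose mu := transfer_op m i p H C; pose phi := transfer_hom m i H.
have mu_rel d a : homogeneous d a -> insertion_sum mu mu d a = 0.
  case/homogeneous_zip=> z [-> -> hz]; rewrite insertion_sumE.
  exact: transfer_op_relation.
have phi_rel d a : homogeneous d a ->
    composition_sum m phi a = insertion_sum phi mu d a.
  case/homogeneous_zip=> z [-> -> hz]; rewrite composition_sumE insertion_sumE.
  exact: transfer_relation.
pose muA := CurvedAinf (transfer_op_linear m i p H C)
  (transfer_op_degree m i_deg p_deg H_deg C_deg) mu_rel.
exists muA; split=> [//|v|]; first by rewrite /= /block_sum big_seq1.
by exists (@AinfHom R V A muA m phi erefl (transfer_hom_linear m i H)
  (transfer_hom_degree m i_deg H_deg) phi_rel).
Qed.
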